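(* Let $G$ be a commutative group and let $h\colon R\to S$ be a morphism of $G$-graded commutative rings. Then: (1) $(h^*,h_* )$ is an adjunction, with $h^*\colon\mathrm{Mod}^G(R)\to\mathrm{Mod}^G(S)$ left adjoint to $h_*\colon\mathrm{Mod}^G(S)\to\mathrm{Mod}^G(R)$, whose unit is $\rho^h$ and whose counit is $\sigma^h$; (2) $(h_*,\widetilde h)$ is an adjunction, with $h_*\colon\mathrm{Mod}^G(S)\to\mathrm{Mod}^G(R)$ left adjoint to $\widetilde h\colon\mathrm{Mod}^G(R)\to\mathrm{Mod}^G(S)$, whose unit is $\widetilde\rho^h$ and whose counit is $\widetilde\sigma^h$.
   Context: All groups and rings are commutative (rings unital). $\mathrm{Mod}^G(R)$ is the category of $G$-graded $R$-modules with degree-preserving $R$-linear maps; $M(g)$ is the shift, $M(g)_{g'}=M_{g+g'}$. The tensor product $M\otimes_RN$ is graded with $x\otimes y$ in degree $\deg x+\deg y$. $\mathrm{Hom}^G_R(M,N)=\bigoplus_{g\in G}\mathrm{Hom}_{\mathrm{Mod}^G(R)}(M,N(g))$, a $G$-graded $R$-module. Change of ring functors: $h_*\colon\mathrm{Mod}^G(S)\to\mathrm{Mod}^G(R)$ is restriction of scalars along $h$ (same grading, $rx=h(r)x$). $h^*\colon\mathrm{Mod}^G(R)\to\mathrm{Mod}^G(S)$, $h^*(M)=S\otimes_RM$ (the graded tensor product $h_*(S)\otimes_RM$ with $s(t\otimes x)=(st)\otimes x$). $\widetilde h\colon\mathrm{Mod}^G(R)\to\mathrm{Mod}^G(S)$,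 $\widetilde h(M)=\mathrm{Hom}^G_R(h_*(S),M)$ with $S$-action $(su)(t)=u(st)$. Natural morphisms, for $M$ in $\mathrm{Mod}^G(R)$ and $N$ in $\mathrm{Mod}^G(S)$: - $\rho^h_M\colon M\to h_*(h^*(M))$, $x\mapsto1_S\otimes x$; - $\sigma^h_N\colon h^*(h_*(N))\to N$, $\sum_is_i\otimes x_i\mapsto\sum_is_ix_i$; - $\widetilde\rho^h_N\colon N\to\widetilde h(h_*(N))$, $x\mapsto(s\mapsto sx)$; - $\widetilde\sigma^h_M\colon h_*(\widetilde h(M))\to M$, $u\mapsto u(1_S)$. *)

(* Defs.v *)
From HB Require Import structures.
From mathcomp Require Import all_boot all_order all_algebra.
From mathcomp Require Import boolp functions.
From mathcomp Require Import generic_quotient ring_quotient.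
From mathcomp Require Import freeg.

Set Implicit Arguments.
Unset Strict Implicit.
Unset Printing Implicit Defensive.

Import GRing.Theory.
Local Open Scope ring_scope.

Record category := Category {
  obj :> Type;
  hom : obj -> obj -> Type;
  idm : forall A, hom A A;
  cmp : forall A B C, hom B C -> hom A B -> hom A C;
  cmp1m : forall A B (f : hom A B), cmp (idm B) f = f;
  cmpm1 : forall A B (f : hom A B), cmp f (idm A) = f;
  cmpA : forall A B C D (f : hom C D) (g : hom B C) (k : hom A B),
    cmp f (cmp g k) = cmp (cmp f g) k }.

Record functor (C D : category) := Functor {
  fobj :> C -> D;
  fmap : forall A B, hom A B -> hom (fobj A) (fobj B);
  fmap1 : forall A, fmap (idm A) = idm (fobj A);
  fmapM : forall (A B E : C) (f : hom B E) (g : hom A B),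
    fmap (cmp f g) = cmp (fmap f) (fmap g) }.

Definition idF (C : category) : functor C C :=
  @Functor C C (fun A => A) (fun _ _ f => f)
    (fun _ => erefl) (fun _ _ _ _ _ => erefl).

Section CompFunctor.
Variables (C D E : category) (U : functor D E) (F : functor C D).

Lemma compF_1 A : fmap U (fmap F (idm A)) = idm (U (F A)).
Proof. by rewrite !fmap1. Qed.

Lemma compF_M (A B B' : C) (f : hom B B') (g : hom A B) :
  fmap U (fmap F (cmp f g)) = cmp (fmap U (fmap F f)) (fmap U (fmap F g)).
Proof. by rewrite !fmapM. Qed.

Definition compF : functor C E :=
  @Functor C E (fun A => U (F A)) (fun _ _ f => fmap U (fmap F f))
    compF_1 compF_M.
End CompFunctor.

Record natTrans (C D : category) (F U : functor C D) := NatTrans {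
  ncomp :> forall A, hom (F A) (U A);
  ncompP : forall A B (f : hom A B),
    cmp (ncomp B) (fmap F f) = cmp (fmap U f) (ncomp A) }.

Record adjunction (C D : category) (F : functor C D) (U : functor D C) :=
  Adjunction {
  adj_to : forall A B, hom (F A) B -> hom A (U B);
  adj_from : forall A B, hom A (U B) -> hom (F A) B;
  adj_toK : forall A B, cancel (@adj_to A B) (@adj_from A B);
  adj_fromK : forall A B, cancel (@adj_from A B) (@adj_to A B);
  adj_natl : forall A A' B (f : hom A' A) (k : hom (F A) B),
    adj_to (cmp k (fmap F f)) = cmp (adj_to k) f;
  adj_natr : forall A B B' (f : hom B B') (k : hom (F A) B),
    adj_to (cmp f k) = cmp (fmap U f) (adj_to k) }.

Section UnitCounit.
Variables (C D : category) (F : functor C D) (U : functor D C).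
Variable a : adjunction F U.

Lemma adj_unit_natural A B (f : hom A B) :
  cmp (adj_to a (idm (F B))) f = cmp (fmap U (fmap F f)) (adj_to a (idm (F A))).
Proof. by rewrite -adj_natl -adj_natr cmp1m cmpm1. Qed.

Definition adj_unit : natTrans (idF C) (compF U F) :=
  @NatTrans _ _ (idF C) (compF U F)
    (fun A => adj_to a (idm (F A))) adj_unit_natural.

Lemma adj_counit_natural A B (f : hom A B) :
  cmp (adj_from a (idm (U B))) (fmap F (fmap U f)) =
  cmp f (adj_from a (idm (U A))).
Proof.
apply: (can_inj (@adj_toK _ _ _ _ a _ _)).
by rewrite adj_natl adj_natr !adj_fromK cmp1m cmpm1.
Qed.

Definition adj_counit : natTrans (compF F U) (idF D) :=
  @NatTrans _ _ (compF F U) (idF D)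
    (fun B => adj_from a (idm (U B))) adj_counit_natural.
End UnitCounit.

Section Grading.
Variable G : zmodType.

Definition in_sum (M : zmodType) (c : G -> M -> Prop) (x : M) : Prop :=
  exists (s : seq G) (f : G -> M),
    [/\ uniq s, forall g, c g (f g) & x = \sum_(g <- s) f g].

Record is_grading (M : zmodType) (c : G -> M -> Prop) : Prop := IsGrading {
  grading0 : forall g, c g 0;
  gradingB : forall g x y, c g x -> c g y -> c g (x - y);
  grading_sum : forall x, in_sum c x;
  grading_direct : forall (s : seq G) (f : G -> M),
    uniq s -> (forall g, c g (f g)) -> \sum_(g <- s) f g = 0 ->
    forall g, g \in s -> f g = 0 }.

Lemma big_uniq_ext (M : zmodType) (s t : seq G) (f : G -> M) :
  uniq s -> uniq t -> {subset s <= t} ->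
  \sum_(g <- s) f g = \sum_(g <- t) (if g \in s then f g else 0).
Proof.
move=> us ut st; rewrite -big_mkcond -big_filter; apply: perm_big.
apply: uniq_perm => //; first exact: filter_uniq.
by move=> x; rewrite mem_filter; case: (boolP (x \in s)) => // /st ->.
Qed.

Section InSum.
Variables (M : zmodType) (c : G -> M -> Prop).
Hypothesis c0 : forall g, c g 0.
Hypothesis cB : forall g x y, c g x -> c g y -> c g (x - y).

Lemma in_sum0 : in_sum c 0.
Proof. by exists [::], (fun=> 0); split => //; rewrite big_nil. Qed.

Lemma in_sumB x y : in_sum c x -> in_sum c y -> in_sum c (x - y).
Proof.
move=> [s [f [us cf ->]]] [t [k [ut ck ->]]].
exists (undup (s ++ t)), (fun g => (if g \in s then f g else 0) -
   (if g \in t then k g else 0)); split.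
- exact: undup_uniq.
- by move=> g; apply: cB; case: ifP.
- rewrite sumrB -!big_uniq_ext ?undup_uniq //.
  + by move=> g gt; rewrite mem_undup mem_cat gt orbT.
  + by move=> g gs; rewrite mem_undup mem_cat gs.
Qed.

Lemma in_sumD x y : in_sum c x -> in_sum c y -> in_sum c (x + y).
Proof.
move=> hx hy; rewrite -[y]opprK -[- y]sub0r.
by apply: in_sumB => //; apply: in_sumB => //; apply: in_sum0.
Qed.

Lemma in_sum_homog g x : c g x -> in_sum c x.
Proof.
move=> cx; exists [:: g], (fun g' => if g' == g then x else 0); split => //.
- by move=> g'; case: eqP => // ->.
- by rewrite big_seq1 eqxx.
Qed.

Lemma in_sum_big (I : Type) (s : seq I) (f : I -> M) :
  (forall i, in_sum c (f i)) -> in_sum c (\sum_(i <- s) f i).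
Proof.
by move=> h; elim/big_ind: _ => //; [exact: in_sum0|exact: in_sumD].
Qed.
End InSum.

Section Projections.
Variables (M : zmodType) (c : G -> M -> Prop) (gr : is_grading c).

Lemma gdec_ex x : exists p : seq G * (G -> M),
  [/\ uniq p.1, forall g, c g (p.2 g) & x = \sum_(g <- p.1) p.2 g].
Proof. by have [s [f sf]] := grading_sum gr x; exists (s, f). Qed.

Definition gsupp (x : M) : seq G := (projT1 (cid (gdec_ex x))).1.
Definition gfam (x : M) : G -> M := (projT1 (cid (gdec_ex x))).2.
Definition gproj (g : G) (x : M) : M :=
  if g \in gsupp x then gfam x g else 0.

Lemma gsupp_uniq x : uniq (gsupp x).
Proof. by rewrite /gsupp; case: (cid _) => p /= []. Qed.

Lemma gfamP x g : c g (gfam x g).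
Proof. by rewrite /gfam; case: (cid _) => p /= [_ cp _]; exact: cp. Qed.

Lemma gproj_homog g x : c g (gproj g x).
Proof. by rewrite /gproj; case: ifP => _; [exact: gfamP|exact: (grading0 gr _)]. Qed.

Lemma gproj_out g x : g \notin gsupp x -> gproj g x = 0.
Proof. by rewrite /gproj => /negPf ->. Qed.

Lemma gproj_sum x : x = \sum_(g <- gsupp x) gproj g x.
Proof.
have -> : \sum_(g <- gsupp x) gproj g x = \sum_(g <- gsupp x) gfam x g.
  by rewrite big_seq [RHS]big_seq; apply: eq_bigr => g; rewrite /gproj => ->.
by rewrite /gfam /gsupp; case: (cid _) => p /= [_ _ e]; exact: e.
Qed.

Lemma gproj_sum_ext x (s : seq G) : uniq s -> {subset gsupp x <= s} ->
  x = \sum_(g <- s) gproj g x.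
Proof.
move=> us sub; rewrite {1}[x]gproj_sum (big_uniq_ext _ (gsupp_uniq x) us sub).
by apply: eq_bigr => g _; rewrite /gproj; case: (g \in gsupp x).
Qed.

Lemma gproj_unique x (s : seq G) (f : G -> M) :
  uniq s -> (forall g, c g (f g)) -> x = \sum_(g <- s) f g ->
  forall g, gproj g x = if g \in s then f g else 0.
Proof.
move=> us cf ex g; pose t := undup (gsupp x ++ s).
have ut : uniq t by exact: undup_uniq.
have st : {subset s <= t} by move=> a h; rewrite mem_undup mem_cat h orbT.
have xt : {subset gsupp x <= t} by move=> a h; rewrite mem_undup mem_cat h.
pose k a := gproj a x - (if a \in s then f a else 0).
have ck a : c a (k a).
  apply: (gradingB gr); first exact: gproj_homog.
  by case: ifP => _ //; exact: (grading0 gr _).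
have sk : \sum_(a <- t) k a = 0.
  by rewrite sumrB -gproj_sum_ext // -big_uniq_ext // -ex subrr.
have [gt|gt] := boolP (g \in t).
  by apply/eqP; rewrite -subr_eq0; apply/eqP; exact: (grading_direct gr ut ck sk gt).
rewrite gproj_out; last by apply: contra gt; exact: xt.
by case: ifP => // /st; rewrite (negPf gt).
Qed.

Lemma gprojB g : {morph gproj g : x y / x - y}.
Proof.
move=> x y; pose t := undup (gsupp x ++ gsupp y).
have ut : uniq t by exact: undup_uniq.
have xt : {subset gsupp x <= t} by move=> a h; rewrite mem_undup mem_cat h.
have yt : {subset gsupp y <= t} by move=> a h; rewrite mem_undup mem_cat h orbT.
rewrite (@gproj_unique (x - y) t (fun a => gproj a x - gproj a y)) //.
- case: ifPn => // gt; rewrite !gproj_out ?subr0 //.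
  + by apply: contra gt; exact: yt.
  + by apply: contra gt; exact: xt.
- by move=> a; apply: (gradingB gr); exact: gproj_homog.
- by rewrite sumrB -!gproj_sum_ext.
Qed.

HB.instance Definition _ g := GRing.isZmodMorphism.Build M M (gproj g) (@gprojB g).

Lemma gproj_at a x g : c a x -> gproj g x = if g == a then x else 0.
Proof.
move=> cx; rewrite (@gproj_unique x [:: a] (fun b => if b == a then x else 0)) //.
- by rewrite inE; case: (g == a).
- by move=> b; case: eqP => [->|_] //; exact: (grading0 gr _).
- by rewrite big_seq1 eqxx.
Qed.

(* Additive maps, or families of elements, are determined on homogeneous
   elements. *)
Lemma grading_ind (P : M -> Prop) :
  P 0 -> (forall x y, P x -> P y -> P (x + y)) ->
  (forall g x, c g x -> P x) -> forall x, P x.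
Proof.
move=> P0 PD Ph x; rewrite [x]gproj_sum.
by elim/big_ind: _ => // g _; apply: (Ph g); exact: gproj_homog.
Qed.
End Projections.

(* A family of additive retractions shows that a sum is direct. *)
Lemma grading_of_proj (M : zmodType) (c : G -> M -> Prop)
    (p : G -> M -> M) :
  (forall g, c g 0) -> (forall g x y, c g x -> c g y -> c g (x - y)) ->
  (forall x, in_sum c x) ->
  (forall g, {morph p g : x y / x - y}) ->
  (forall a x g, c a x -> p g x = if g == a then x else 0) ->
  is_grading c.
Proof.
move=> c0 cB cs pB pc; split => // s f us cf sf g gs.
have p0 a : p a 0 = 0 by have := pB a 0 0; rewrite !subrr.
have pD a : {morph p a : x y / x + y}.
  by move=> x y; rewrite -{1}[y]opprK pB -[- y]sub0r pB p0 sub0r opprK.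
have : p g (\sum_(a <- s) f a) = 0 by rewrite sf.
rewrite (big_morph (p g) (pD g) (p0 g)) (bigD1_seq g) //= (pc g) // eqxx.
rewrite big1 ?addr0 // => a /negPf ag.
by rewrite (pc a) // eq_sym ag.
Qed.
End Grading.

Section GradedStructures.
Variable G : zmodType.

Record gradedRing := GradedRing {
  gring :> comPzRingType;
  gring_comp : G -> gring -> Prop;
  gring_grading : is_grading gring_comp;
  gring_mul : forall g g' x y,
    gring_comp g x -> gring_comp g' y -> gring_comp (g + g') (x * y) }.

Record gradedModule (R : gradedRing) := GradedModule {
  gmod :> lmodType R;
  gmod_comp : G -> gmod -> Prop;
  gmod_grading : is_grading gmod_comp;
  gmod_scale : forall g g' (r : R) x,
    gring_comp g r -> gmod_comp g' x -> gmod_comp (g + g') (r *: x) }.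

Record gradedRingHom (R S : gradedRing) := GradedRingHom {
  grhom :> {rmorphism R -> S};
  grhom_deg : forall g x, gring_comp g x -> gring_comp g (grhom x) }.

Record gradedHom (R : gradedRing) (M N : gradedModule R) := GradedHom {
  ghom :> M -> N;
  ghom_linear : linear ghom;
  ghom_deg : forall g x, gmod_comp g x -> gmod_comp g (ghom x) }.

HB.instance Definition _ R M N (f : @gradedHom R M N) :=
  GRing.isLinear.Build R M N *:%R (ghom f) (@ghom_linear R M N f).

Lemma gradedHomP R (M N : gradedModule R) (f k : gradedHom M N) :
  f =1 k -> f = k.
Proof.
case: f k => [f fl fd] [k kl kd] /= /funext e; case: _ / e in kl kd *.
by rewrite (Prop_irrelevance fl kl) (Prop_irrelevance fd kd).
Qed.

Lemma gring_comp1 (R : gradedRing) : gring_comp 0 (1 : R).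
Proof.
set gr := gring_grading R; set e := gproj gr 0 1.
suff /(_ 1) : forall x : R, x * e = x.
  by rewrite mul1r => <-; exact: gproj_homog.
apply: (grading_ind gr) => [|x y hx hy|a x cx]; first by rewrite mul0r.
  by rewrite mulrDl hx hy.
rewrite -[RHS](_ : gproj gr a x = x); last by rewrite (gproj_at gr _ cx) eqxx.
pose s := gsupp gr 1.
have ex : x = \sum_(g <- [seq a + b | b <- s]) x * gproj gr (g - a) 1.
  rewrite big_map -[LHS]mulr1 {1}(gproj_sum gr 1) mulr_sumr.
  by apply: eq_bigr => b _; rewrite [a + b]addrC addrK.
rewrite (gproj_unique gr _ _ ex).
- rewrite subrr -/e -{1}[a]addr0 mem_map; last exact: addrI.
  by case: ifPn => // h; rewrite /e gproj_out ?mulr0.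
- by rewrite map_inj_uniq ?gsupp_uniq //; exact: addrI.
- by move=> g; rewrite -{1}[g](subrK a) addrC; apply: gring_mul => //; exact: gproj_homog.
Qed.

Section Shift.
Variables (R : gradedRing) (M : gradedModule R) (g : G).

Definition shift_comp (g' : G) (x : M) : Prop := gmod_comp (g + g') x.

Lemma shift_grading : is_grading shift_comp.
Proof.
set gr := gmod_grading M.
apply: (@grading_of_proj _ _ _ (fun a => gproj gr (g + a))).
- by move=> a; exact: (grading0 gr _).
- by move=> a x y; exact: (gradingB gr).
- move=> x; exists [seq a - g | a <- gsupp gr x], (fun a => gproj gr (g + a) x).
  split.
  + by rewrite map_inj_uniq ?gsupp_uniq //; exact: addIr.
  + by move=> a; exact: gproj_homog.
  + by rewrite big_map {1}(gproj_sum gr x); apply: eq_bigr => a _; rewrite addrC subrK.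
- by move=> a x y; exact: gprojB.
- by move=> a x b cx; rewrite (gproj_at gr _ cx) (inj_eq (addrI g)).
Qed.

Lemma shift_scale a b (r : R) x :
  gring_comp a r -> shift_comp b x -> shift_comp (a + b) (r *: x).
Proof. by move=> ha hb; rewrite /shift_comp addrCA; exact: gmod_scale. Qed.

Definition shift : gradedModule R := GradedModule shift_grading shift_scale.
End Shift.

Definition regular (R : gradedRing) : gradedModule R :=
  @GradedModule R R^o (@gring_comp R) (gring_grading R) (@gring_mul R).

Section ModG.
Variable R : gradedRing.

Definition ghom_id (M : gradedModule R) : gradedHom M M :=
  @GradedHom R M M id (fun _ _ _ => erefl) (fun _ _ => id).

Section Comp.
Variables (M N P : gradedModule R) (f : gradedHom N P) (k : gradedHom M N).
Lemma ghom_comp_linear : linear (fun x => f (k x)).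
Proof. by move=> a x y; rewrite !linearP. Qed.
Definition ghom_comp : gradedHom M P :=
  GradedHom ghom_comp_linear (fun g x cx => ghom_deg f (ghom_deg k cx)).
End Comp.

Lemma ghom_comp1f M N (f : gradedHom M N) : ghom_comp (ghom_id N) f = f.
Proof. exact: gradedHomP. Qed.
Lemma ghom_compf1 M N (f : gradedHom M N) : ghom_comp f (ghom_id M) = f.
Proof. exact: gradedHomP. Qed.
Lemma ghom_compA M N P Q (f : gradedHom P Q) (k : gradedHom N P)
  (l : gradedHom M N) :
  ghom_comp f (ghom_comp k l) = ghom_comp (ghom_comp f k) l.
Proof. exact: gradedHomP. Qed.

Definition ModG : category :=
  @Category (gradedModule R) (@gradedHom R) ghom_id ghom_comp
    ghom_comp1f ghom_compf1 ghom_compA.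
End ModG.
End GradedStructures.

Section Tensor.
Variables (R : comPzRingType) (M N : lmodType R).

Inductive tens_rel : {freeg (M * N)%type} -> Prop :=
| tens_rel0 : tens_rel 0
| tens_relB p q : tens_rel p -> tens_rel q -> tens_rel (p - q)
| tens_rel_addl x x' y :
    tens_rel (<< (x + x', y) >> - << (x, y) >> - << (x', y) >>)
| tens_rel_addr x y y' :
    tens_rel (<< (x, y + y') >> - << (x, y) >> - << (x, y') >>)
| tens_rel_scale r x y :
    tens_rel (<< (r *: x, y) >> - << (x, r *: y) >>).

Definition tens_pred : {pred {freeg (M * N)%type}} := fun p => `[< tens_rel p >].

Lemma tens_pred_zmod_closed : zmod_closed tens_pred.
Proof.
split; first by apply/asboolP; exact: tens_rel0.
by move=> p q /asboolP hp /asboolP hq; apply/asboolP; exact: tens_relB.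
Qed.

HB.instance Definition _ := GRing.isZmodClosed.Build _ tens_pred tens_pred_zmod_closed.

Definition tens : Type := Quotient.quot tens_pred.
HB.instance Definition _ := GRing.Zmodule.on tens.

Definition tens_pi (p : {freeg (M * N)%type}) : tens :=
  \pi_(Quotient.quot tens_pred)%qT p.

Lemma tens_pi_is_zmod_morphism : zmod_morphism tens_pi.
Proof. by move=> p q; exact: (raddfB \pi_(Quotient.quot tens_pred)%qT). Qed.

HB.instance Definition _ :=
  GRing.isZmodMorphism.Build _ _ tens_pi tens_pi_is_zmod_morphism.

Definition tensor (x : M) (y : N) : tens := tens_pi << (x, y) >>.

Lemma tens_relP p : tens_rel p -> tens_pi p = 0.
Proof.
move=> hp; rewrite -(raddf0 tens_pi).
apply/eqP; rewrite -[_ == _]Quotient.idealrBE subr0; exact/asboolP.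
Qed.

Lemma tens_piK (t : tens) : tens_pi (repr (t : Quotient.quot tens_pred)) = t.
Proof. exact: reprK. Qed.

Lemma tens_pi_rel p : tens_rel (repr (tens_pi p : Quotient.quot tens_pred) - p).
Proof.
have /asboolP // : repr (tens_pi p : Quotient.quot tens_pred) - p \in tens_pred.
by rewrite Quotient.idealrBE reprK.
Qed.

Lemma tensorDl x x' y : tensor (x + x') y = tensor x y + tensor x' y.
Proof.
apply/eqP; rewrite -subr_eq0 opprD addrA; apply/eqP.
rewrite /tensor -[RHS](tens_relP (tens_rel_addl x x' y)).
by rewrite !raddfB.
Qed.

Lemma tensorDr x y y' : tensor x (y + y') = tensor x y + tensor x y'.
Proof.
apply/eqP; rewrite -subr_eq0 opprD addrA; apply/eqP.
rewrite /tensor -[RHS](tens_relP (tens_rel_addr x y y')).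
by rewrite !raddfB.
Qed.

Lemma tensorZ r x y : tensor (r *: x) y = tensor x (r *: y).
Proof.
apply/eqP; rewrite -subr_eq0; apply/eqP.
rewrite /tensor -[RHS](tens_relP (tens_rel_scale r x y)).
by rewrite !raddfB.
Qed.

Lemma tens_ind (P : tens -> Prop) :
  P 0 -> (forall p q, P p -> P q -> P (p - q)) ->
  (forall x y, P (tensor x y)) -> forall t, P t.
Proof.
move=> P0 PB Pt t; rewrite -[t]tens_piK -[repr t]freeg_sumE.
have PD p q : P p -> P q -> P (p + q).
  by move=> hp hq; rewrite -[q]opprK -[- q]sub0r; apply: (PB) => //; exact: (PB).
rewrite raddf_sum; elim/big_ind: _ => // -[x y] _.
have -> : << coeff (x, y) (repr t) *g (x, y) >> =
   << (x, y) >> *~ coeff (x, y) (repr t) by rewrite freegU_mulz intz.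
rewrite raddfMz /=.
have Pn n : P (tensor x y *+ n) by elim: n => // n ih; rewrite mulrS; exact: PD.
case: (coeff _ _) => n; first exact: Pn.
by rewrite NegzE mulrNz -[- _]sub0r; apply: (PB) => //; exact: (Pn n.+1).
Qed.

Record balanced (P : zmodType) (f : M -> N -> P) : Prop := Balanced {
  balancedDl : forall x x' y, f (x + x') y = f x y + f x' y;
  balancedDr : forall x y y', f x (y + y') = f x y + f x y';
  balancedZ : forall r x y, f (r *: x) y = f x (r *: y) }.

Definition tens_lift (P : zmodType) (f : M -> N -> P) (t : tens) : P :=
  fglift (fun p : M * N => f p.1 p.2 : zmodule P) (repr t).

Section Lift.
Variables (P : zmodType) (f : M -> N -> P) (bf : balanced f).

Let L := fglift (fun p : M * N => f p.1 p.2 : zmodule P).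

Let LB : {morph L : p q / p - q}.
Proof. exact: lift_is_additive. Qed.

Let LU x y : L << (x, y) >> = f x y.
Proof. by rewrite /L liftU scale1r. Qed.

Let L_rel p : tens_rel p -> L p = 0.
Proof.
elim=> [|p1 p2 _ h1 _ h2|x x' y|x y y'|r x y].
- by have := LB 0 0; rewrite !subrr.
- by rewrite LB h1 h2 subrr.
- by rewrite !LB !LU (balancedDl bf) -addrA -opprD subrr.
- by rewrite !LB !LU (balancedDr bf) -addrA -opprD subrr.
- by rewrite !LB !LU (balancedZ bf) subrr.
Qed.

Let L_pi p : tens_lift f (tens_pi p) = L p.
Proof.
by apply/eqP; rewrite -subr_eq0 -LB; apply/eqP/L_rel/tens_pi_rel.
Qed.

Lemma tens_lift_is_zmod_morphism : zmod_morphism (tens_lift f).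
Proof.
move=> s t; rewrite -[s]tens_piK -[t]tens_piK -raddfB.
by rewrite !L_pi LB.
Qed.

Lemma tens_liftE x y : tens_lift f (tensor x y) = f x y.
Proof. by rewrite L_pi LU. Qed.

Lemma tens_lift0 : tens_lift f 0 = 0.
Proof. by have := tens_lift_is_zmod_morphism 0 0; rewrite !subrr. Qed.

Lemma tens_liftD : {morph tens_lift f : s t / s + t}.
Proof.
move=> s t; rewrite -{1}[t]opprK -[- t]sub0r !tens_lift_is_zmod_morphism.
by rewrite tens_lift0 sub0r opprK.
Qed.

End Lift.

Lemma tens_ext (P : zmodType) (f k : tens -> P) :
  zmod_morphism f -> zmod_morphism k ->
  (forall x y, f (tensor x y) = k (tensor x y)) -> f =1 k.
Proof.
move=> fB kB fk; apply: tens_ind => [|p q hp hq|//].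
  by have := fB 0 0; have := kB 0 0; rewrite !subrr => -> ->.
by rewrite fB kB hp hq.
Qed.

Lemma tensor0l y : tensor 0 y = 0.
Proof. by apply: (addrI (tensor 0 y)); rewrite -tensorDl !addr0. Qed.

Lemma tensor0r x : tensor x 0 = 0.
Proof. by apply: (addrI (tensor x 0)); rewrite -tensorDr !addr0. Qed.

Lemma tensor_suml (I : Type) (s : seq I) (f : I -> M) y :
  tensor (\sum_(i <- s) f i) y = \sum_(i <- s) tensor (f i) y.
Proof. exact: (big_morph (tensor^~ y) (fun a b => tensorDl a b y) (tensor0l y)). Qed.

Lemma tensor_sumr (I : Type) (s : seq I) x (f : I -> N) :
  tensor x (\sum_(i <- s) f i) = \sum_(i <- s) tensor x (f i).
Proof. exact: (big_morph (tensor x) (tensorDr x) (tensor0r x)). Qed.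
End Tensor.

Section GradedTensor.
Variables (G : zmodType) (R : gradedRing G) (M N : gradedModule R).

Inductive tens_comp (g : G) : tens M N -> Prop :=
| tens_comp0 : tens_comp g 0
| tens_compB s t : tens_comp g s -> tens_comp g t -> tens_comp g (s - t)
| tens_comp_tensor a b x y : gmod_comp a x -> gmod_comp b y -> a + b = g ->
    tens_comp g (tensor x y).

Let gM := gmod_grading M.
Let gN := gmod_grading N.

Let bi (g : G) (x : M) (y : N) : tens M N :=
  \sum_(a <- gsupp gM x) tensor (gproj gM a x) (gproj gN (g - a) y).

Let bi_ext g x y (t : seq G) : uniq t -> {subset gsupp gM x <= t} ->
  bi g x y = \sum_(a <- t) tensor (gproj gM a x) (gproj gN (g - a) y).
Proof.
move=> ut st; rewrite /bi (big_uniq_ext _ (gsupp_uniq gM x) ut st).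
apply: eq_bigr => a _; case: ifPn => // h.
by rewrite gproj_out // tensor0l.
Qed.

Let biDl g x x' y : bi g (x + x') y = bi g x y + bi g x' y.
Proof.
pose t := undup (gsupp gM (x + x') ++ gsupp gM x ++ gsupp gM x').
have ut : uniq t by exact: undup_uniq.
rewrite !(@bi_ext g _ y t ut); first last.
- by move=> a h; rewrite mem_undup !mem_cat h.
- by move=> a h; rewrite mem_undup !mem_cat h ?orbT.
- by move=> a h; rewrite mem_undup !mem_cat h ?orbT.
by rewrite -big_split; apply: eq_bigr => a _; rewrite raddfD tensorDl.
Qed.

Let biDr g x y y' : bi g x (y + y') = bi g x y + bi g x y'.
Proof. by rewrite -big_split; apply: eq_bigr => a _; rewrite raddfD tensorDr. Qed.

Let bi_homog g a x y : gmod_comp a x -> bi g x y = tensor x (gproj gN (g - a) y).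
Proof.
move=> cx; rewrite (@bi_ext g x y (undup (a :: gsupp gM x))) ?undup_uniq //; last first.
  by move=> b h; rewrite mem_undup inE h orbT.
rewrite (bigD1_seq a) ?undup_uniq ?mem_undup ?mem_head //=.
rewrite (gproj_at gM _ cx) eqxx big1 ?addr0 // => b /negPf ba.
by rewrite (gproj_at gM _ cx) ba tensor0l.
Qed.

Let gproj_scale d r g (y : N) : gring_comp d r ->
  gproj gN (d + g) (r *: y) = r *: gproj gN g y.
Proof.
move=> cr; elim/(grading_ind gN): y g => [|y y' hy hy'|b y cy] g.
- by rewrite scaler0 !raddf0.
- by rewrite scalerDr !raddfD /= hy hy'.
- rewrite (gproj_at gN _ (gmod_scale cr cy)) (gproj_at gN _ cy).
  by rewrite (inj_eq (addrI d)); case: ifP => // _; rewrite scaler0.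
Qed.

Let bi_balanced g : balanced (bi g).
Proof.
split=> [||r x y]; [exact: biDl|exact: biDr|].
have bi0l y' : bi g 0 y' = 0 by apply: (addrI (bi g 0 y')); rewrite -biDl !addr0.
have bi0r x' : bi g x' 0 = 0 by apply: (addrI (bi g x' 0)); rewrite -biDr !addr0.
elim/(grading_ind (gring_grading R)): r x => [|r r' h h'|d r cr] x.
- by rewrite !scale0r bi0l bi0r.
- by rewrite !scalerDl biDl biDr h h'.
elim/(grading_ind gM): x => [|x x' h h'|a x cx].
- by rewrite scaler0 !bi0l.
- by rewrite scalerDr !biDl h h'.
- rewrite (bi_homog _ _ (gmod_scale cr cx)) (bi_homog _ _ cx) tensorZ.
  by rewrite -(gproj_scale _ _ cr) opprD !addrA [d + g]addrC addrK.
Qed.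

Lemma tens_grading : is_grading tens_comp.
Proof.
apply: (@grading_of_proj _ _ _ (fun g => tens_lift (bi g))).
- exact: tens_comp0.
- exact: tens_compB.
- apply: tens_ind => [|p q|x y].
  + exact: in_sum0 tens_comp0.
  + exact: in_sumB tens_comp0 tens_compB _ _.
  + rewrite (gproj_sum gM x) tensor_suml.
    apply: (in_sum_big tens_comp0 tens_compB) => a.
    rewrite (gproj_sum gN y) tensor_sumr.
    apply: (in_sum_big tens_comp0 tens_compB) => b.
    apply: (in_sum_homog tens_comp0 (g := a + b)).
    by apply: tens_comp_tensor; [exact: gproj_homog|exact: gproj_homog|].
- by move=> g; exact: tens_lift_is_zmod_morphism.
- move=> a t g; elim=> [|p q _ hp _ hq|c b x y cx cy <-].
  + by rewrite tens_lift0 // if_same.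
  + rewrite tens_lift_is_zmod_morphism // hp hq.
    by case: ifP => // _; rewrite subrr.
  + rewrite tens_liftE // (bi_homog _ _ cx) (gproj_at gN _ cy).
    by rewrite subr_eq addrC; case: ifP => // _; rewrite tensor0r.
Qed.
End GradedTensor.

Section Restriction.
Variables (R S : pzRingType).

Definition restr (h : {rmorphism R -> S}) (N : lmodType S) : Type := N.

Variables (h : {rmorphism R -> S}) (N : lmodType S).
Local Notation hN := (restr h N).

HB.instance Definition _ := GRing.Zmodule.copy hN N.

Let scale (r : R) (x : hN) : hN := h r *: (x : N).

Fact restr_scaleA a b x : scale a (scale b x) = scale (a * b) x.
Proof. by rewrite /scale scalerA rmorphM. Qed.
Fact restr_scale1 : left_id 1 scale.
Proof. by move=> x; rewrite /scale rmorph1 scale1r. Qed.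
Fact restr_scaleDr : right_distributive scale +%R.
Proof. by move=> a x y; rewrite /scale scalerDr. Qed.
Fact restr_scaleDl x : {morph scale^~ x : a b / a + b}.
Proof. by move=> a b; rewrite /scale rmorphD scalerDl. Qed.

HB.instance Definition _ := GRing.Zmodule_isLmodule.Build R hN
  restr_scaleA restr_scale1 restr_scaleDr restr_scaleDl.

Lemma restr_scaleE (r : R) (x : hN) : r *: x = (h r *: (x : N) : N).
Proof. by []. Qed.
End Restriction.

Section GradedRestriction.
Variables (G : zmodType) (R S : gradedRing G) (h : gradedRingHom R S).

Lemma restr_gmod_scale (N : gradedModule S) g g' (r : R) (x : restr h N) :
  gring_comp g r -> @gmod_comp G S N g' x ->
  @gmod_comp G S N (g + g') (r *: x).
Proof. by move=> cr cx; apply: gmod_scale => //; exact: grhom_deg. Qed.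

Definition restr_mod (N : gradedModule S) : gradedModule R :=
  @GradedModule G R (restr h N) (@gmod_comp G S N) (gmod_grading N)
    (@restr_gmod_scale N).

End GradedRestriction.

Section RestrFunctor.
Variables (G : zmodType) (R S : gradedRing G) (h : gradedRingHom R S).

Section Map.
Variables (N N' : gradedModule S) (f : gradedHom N N').
Fact restr_map_linear : linear (f : restr_mod h N -> restr_mod h N').
Proof. by move=> r x y; rewrite !restr_scaleE; exact: (linearP f). Qed.
Definition restr_map : gradedHom (restr_mod h N) (restr_mod h N') :=
  @GradedHom G R (restr_mod h N) (restr_mod h N') f restr_map_linear
    (@ghom_deg _ _ _ _ f).
End Map.

Fact restr_map1 N : restr_map (ghom_id N) = ghom_id (restr_mod h N).
Proof. exact: gradedHomP. Qed.

Fact restr_mapM (N P Q : gradedModule S) (f : gradedHom P Q)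
    (k : gradedHom N P) :
  restr_map (ghom_comp f k) = ghom_comp (restr_map f) (restr_map k).
Proof. exact: gradedHomP. Qed.

Definition restrF : functor (ModG S) (ModG R) :=
  @Functor (ModG S) (ModG R) (restr_mod h) restr_map restr_map1 restr_mapM.
End RestrFunctor.

Section Extension.
Variables (R S : comPzRingType).

Definition ext (h : {rmorphism R -> S}) (M : lmodType R) : Type :=
  tens (restr h S^o) M.

Variables (h : {rmorphism R -> S}) (M : lmodType R).
Local Notation hM := (ext h M).

HB.instance Definition _ := GRing.Zmodule.copy hM (tens (restr h S^o) M).

Definition pure (s : S) (x : M) : hM := tensor (s : restr h S^o) x.

Let scale (s : S) (t : hM) : hM := 
  tens_lift (fun (s' : restr h S^o) x => pure (s * s') x) t.

Fact ext_balanced (s : S) :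
  balanced (fun (s' : restr h S^o) (x : M) => pure (s * s') x).
Proof.
split=> [a b x|a x y|r a x].
- by rewrite -[s * _]/(s * ((a : S) + b)) mulrDr; exact: tensorDl.
- exact: tensorDr.
- by rewrite -[s * _]/(s * (h r * (a : S))) mulrCA; exact: tensorZ.
Qed.

Fact ext_scale_pure s s' x : scale s (pure s' x) = pure (s * s') x.
Proof. by rewrite /scale tens_liftE //; exact: ext_balanced. Qed.

Fact ext_scaleB s : zmod_morphism (scale s).
Proof. exact: tens_lift_is_zmod_morphism (ext_balanced s). Qed.

Fact ext_scaleA a b t : scale a (scale b t) = scale (a * b) t.
Proof.
move: t; apply: tens_ext => [p q|p q|s x].
- by rewrite !ext_scaleB.
- by rewrite ext_scaleB.
- by rewrite !ext_scale_pure mulrA.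
Qed.

Fact ext_scale1 : left_id 1 scale.
Proof.
apply: tens_ext => [p q|//|s x]; first by rewrite ext_scaleB.
by rewrite ext_scale_pure mul1r.
Qed.

Fact ext_scaleDr : right_distributive scale +%R.
Proof. by move=> s; exact: tens_liftD (ext_balanced s). Qed.

Fact ext_scaleDl t : {morph scale^~ t : a b / a + b}.
Proof.
move=> a b; move: t; apply: tens_ext => [p q|p q|s x].
- by rewrite ext_scaleB.
- by rewrite !ext_scaleB opprD addrACA.
- by rewrite !ext_scale_pure mulrDl; exact: tensorDl.
Qed.

HB.instance Definition _ := GRing.Zmodule_isLmodule.Build S hM
  ext_scaleA ext_scale1 ext_scaleDr ext_scaleDl.

Lemma ext_scaleE (s s' : S) (x : M) : s *: pure s' x = pure (s * s') x.
Proof. exact: ext_scale_pure. Qed.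

Lemma ext_ext (P : zmodType) (f k : hM -> P) :
  zmod_morphism f -> zmod_morphism k ->
  (forall s x, f (pure s x) = k (pure s x)) -> f =1 k.
Proof. exact: tens_ext. Qed.

End Extension.

Section ExtFunctor.
Variables (G : zmodType) (R S : gradedRing G) (h : gradedRingHom R S).

Definition ext_comp (M : gradedModule R) : G -> ext h M -> Prop :=
  @tens_comp G R (restr_mod h (regular S)) M.

Fact ext_grading M : is_grading (@ext_comp M).
Proof. exact: (@tens_grading G R (restr_mod h (regular S)) M). Qed.

Fact ext_gmod_scale (M : gradedModule R) g g' (s : S) (t : ext h M) :
  gring_comp g s -> ext_comp g' t -> ext_comp (g + g') (s *: t).
Proof.
move=> cs; elim=> [|p q _ hp _ hq|a b x y cx cy <-].
- by rewrite [s *: _]scaler0; exact: tens_comp0.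
- by rewrite [s *: _](scalerBr s (p : ext h M)); exact: tens_compB.
- rewrite [s *: _](ext_scaleE h s x y) addrA.
  apply: (tens_comp_tensor (a := g + a) (b := b)) => //.
  exact: gring_mul.
Qed.

Definition ext_mod (M : gradedModule R) : gradedModule S :=
  @GradedModule G S (ext h M) (@ext_comp M) (ext_grading M)
    (@ext_gmod_scale M).

Section Map.
Variables (M M' : gradedModule R) (f : gradedHom M M').

Definition ext_map_fun (t : ext_mod M) : ext_mod M' :=
  tens_lift (fun (s : restr h S^o) x => pure h s (f x)) t.

Fact ext_map_balanced : balanced
  (fun (s : restr h S^o) (x : M) => pure h s (f x) : ext_mod M').
Proof.
split=> [a b x|a x y|r a x].
- exact: tensorDl.
- by rewrite raddfD; exact: tensorDr.
- by rewrite linearZ; exact: tensorZ.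
Qed.

Fact ext_map_pure s x : ext_map_fun (pure h s x) = pure h s (f x).
Proof. exact: tens_liftE ext_map_balanced s x. Qed.

Fact ext_mapB : zmod_morphism ext_map_fun.
Proof. exact: tens_lift_is_zmod_morphism ext_map_balanced. Qed.

Fact ext_map_linear : linear ext_map_fun.
Proof.
move=> s t u.
have -> : ext_map_fun (s *: t + u) = ext_map_fun (s *: t) + ext_map_fun u.
  exact: (tens_liftD ext_map_balanced).
congr (_ + _); move: t.
apply: (ext_ext (f := fun t : ext_mod M => ext_map_fun (s *: t))
  (k := fun t : ext_mod M => s *: ext_map_fun t)) => [p q|p q|s' x].
- by rewrite -ext_mapB -(scalerBr s (p : ext_mod M)).
- by rewrite -scalerBr -ext_mapB.
- by rewrite ext_map_pure ext_scaleE ext_map_pure ext_scaleE.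
Qed.

Fact ext_map_deg g t : gmod_comp g t -> gmod_comp g (ext_map_fun t).
Proof.
elim=> [|p q _ hp _ hq|a b s x cs cx e].
- have -> : ext_map_fun 0 = 0 by exact: (tens_lift0 ext_map_balanced).
  exact: tens_comp0.
- have -> : ext_map_fun (p - q) = ext_map_fun p - ext_map_fun q.
    exact: ext_mapB.
  exact: tens_compB.
- rewrite ext_map_pure; apply: tens_comp_tensor cs _ e.
  exact: ghom_deg.
Qed.

Definition ext_map : gradedHom (ext_mod M) (ext_mod M') :=
  GradedHom ext_map_linear ext_map_deg.
End Map.

Fact ext_map1 M : ext_map (ghom_id M) = ghom_id (ext_mod M).
Proof.
apply: gradedHomP; apply: tens_ext => [p q|p q|s x] //.
- exact: ext_mapB.
- exact: ext_map_pure.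
Qed.

Fact ext_mapM (M N P : gradedModule R) (f : gradedHom N P)
    (k : gradedHom M N) :
  ext_map (ghom_comp f k) = ghom_comp (ext_map f) (ext_map k).
Proof.
apply: gradedHomP; apply: tens_ext => [p q|p q|s x].
- exact: ext_mapB.
- by rewrite /= !ext_mapB.
- by rewrite /= !ext_map_pure.
Qed.

Definition extF : functor (ModG R) (ModG S) :=
  @Functor (ModG R) (ModG S) ext_mod ext_map ext_map1 ext_mapM.
End ExtFunctor.

Section GradedHomModule.
Variables (G : zmodType) (R : gradedRing G) (M N : gradedModule R).

(* [shift N g] has the same underlying module as [N], so that the groups
   Hom(M, N(g)) of the category of graded modules are all subgroups of the
   group of maps [M -> N].  Their sum there is direct ([homG_grading]), and
   [homG] below is this internal direct sum. *)
Definition homG_fun_comp (g : G) (u : M -> N) : Prop :=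
  exists f : gradedHom M (shift N g), u = f.

Fact homG_fun_comp0 g : homG_fun_comp g 0.
Proof.
have l : linear (0 : M -> shift N g) by move=> a x y; rewrite scaler0 addr0.
have d b x : gmod_comp b x -> @gmod_comp _ _ (shift N g) b ((0 : M -> N) x).
  by move=> _; exact: (grading0 (gmod_grading (shift N g))).
by exists (GradedHom l d).
Qed.

Fact homG_fun_compB g u v :
  homG_fun_comp g u -> homG_fun_comp g v -> homG_fun_comp g (u - v).
Proof.
move=> [f ->] [k ->].
have l : linear (fun x => f x - k x : shift N g).
  by move=> a x y; rewrite (linearP f) (linearP k) scalerBr opprD addrACA.
have d b x : gmod_comp b x -> @gmod_comp _ _ (shift N g) b (f x - k x).
  move=> cx; apply: (gradingB (gmod_grading (shift N g))); exact: ghom_deg.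
by exists (GradedHom l d).
Qed.

Definition homG_pred : {pred M -> N} := fun u => `[< in_sum homG_fun_comp u >].

Fact homG_zmod_closed : zmod_closed homG_pred.
Proof.
split; first by apply/asboolP; exact: in_sum0 homG_fun_comp0.
move=> u v /asboolP hu /asboolP hv; apply/asboolP.
exact: in_sumB homG_fun_comp0 homG_fun_compB _ _ hu hv.
Qed.

HB.instance Definition _ :=
  GRing.isZmodClosed.Build _ homG_pred homG_zmod_closed.

Record homG : Type := HomG {
  homG_fun :> M -> N;
  homG_funP : homG_fun \in homG_pred }.

HB.instance Definition _ := [isSub for homG_fun].
HB.instance Definition _ := [Choice of homG by <:].
HB.instance Definition _ := [SubChoice_isSubZmodule of homG by <:].

Lemma homG_fun_sum (I : Type) (s : seq I) (f : I -> homG) :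
  homG_fun (\sum_(i <- s) f i) = \sum_(i <- s) homG_fun (f i).
Proof. exact: (big_morph homG_fun (fun _ _ => erefl) erefl). Qed.

Lemma homGP (u v : homG) : (forall x, u x = v x) -> u = v.
Proof. by move=> /funext e; exact: val_inj. Qed.

Lemma homG_sumP (u : homG) : in_sum homG_fun_comp u.
Proof. by apply/asboolP; exact: homG_funP. Qed.

Lemma homG_linear (u : homG) : linear u.
Proof.
have [s [f [_ cf ->]]] := homG_sumP u.
move=> a x y; rewrite !fct_sumE scaler_sumr -big_split; apply: eq_bigr => g _.
by have [k ->] := cf g; rewrite linearP.
Qed.

HB.instance Definition _ (u : homG) :=
  GRing.isLinear.Build R M N *:%R (homG_fun u) (homG_linear u).

Definition homG_comp (g : G) (u : homG) : Prop := homG_fun_comp g u.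

Fact homG_in_sum (u : homG) : in_sum homG_comp u.
Proof.
have [s [f [us cf e]]] := homG_sumP u.
have hf g : f g \in homG_pred.
  by apply/asboolP; exact: in_sum_homog homG_fun_comp0 _ _ (cf g).
exists s, (fun g => HomG (hf g)); split => //.
by apply: val_inj; rewrite /= homG_fun_sum e.
Qed.

Lemma homG_comp_deg g a (u : homG) x :
  homG_comp g u -> gmod_comp a x -> gmod_comp (g + a) (u x).
Proof. by move=> [f ->] cx; exact: (ghom_deg f cx). Qed.

Lemma homG_funB (u v : homG) x : (u - v) x = u x - v x.
Proof. by []. Qed.

Lemma homG_fun0 x : (0 : homG) x = 0.
Proof. by []. Qed.

Fact homG_grading : is_grading homG_comp.
Proof.
split=> [g|g u v|u|s f us cf sf g gs].
- exact: homG_fun_comp0.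
- exact: homG_fun_compB.
- exact: homG_in_sum.
apply: homGP => x; rewrite homG_fun0.
elim/(grading_ind (gmod_grading M)): x => [|x y hx hy|a x cx].
- exact: raddf0.
- by rewrite raddfD /= hx hy addr0.
have dir := grading_direct (gmod_grading (shift N a)) us (f := fun b => f b x).
apply: dir => // [b|].
  by have := homG_comp_deg (cf b) cx; rewrite addrC.
have -> : \sum_(b <- s) f b x = (\sum_(b <- s) f b) x.
  by rewrite homG_fun_sum fct_sumE.
by rewrite sf.
Qed.
End GradedHomModule.

Section Coextension.
Variables (G : zmodType) (R S : gradedRing G).

Definition coext (h : gradedRingHom R S) (M : gradedModule R) : Type :=
  homG (restr_mod h (regular S)) M.

Variables (h : gradedRingHom R S) (M : gradedModule R).
Local Notation hM := (coext h M).
Local Notation hS := (restr_mod h (regular S)).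

HB.instance Definition _ := GRing.Zmodule.copy hM (homG hS M).

Fact coext_scale_comp d g (s : S) (u : hS -> M) :
  gring_comp d s -> homG_fun_comp g u ->
  homG_fun_comp (d + g) (fun t : hS => u (s * (t : S))).
Proof.
move=> cs [f ->].
have l : linear (fun t : hS => f (s * (t : S)) : shift M (d + g)).
  move=> a x y.
  have -> : s * ((a *: x + y : hS) : S) = (a *: (s * x : hS) + (s * y : S) : hS).
    by rewrite [LHS]mulrDr [s * (h a * _)]mulrCA.
  exact: (linearP f).
have dg b (x : hS) : gmod_comp b x ->
    @gmod_comp _ _ (shift M (d + g)) b (f (s * (x : S))).
  move=> cx; rewrite /= /shift_comp [d + g]addrC -addrA.
  by apply: (ghom_deg f); exact: gring_mul.
by exists (GradedHom l dg).
Qed.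

Fact coext_scaleP (s : S) (u : hM) :
  (fun t : hS => u (s * (t : S))) \in @homG_pred _ _ hS M.
Proof.
apply/asboolP.
have c0 := @homG_fun_comp0 _ _ hS M; have cB := @homG_fun_compB _ _ hS M.
have -> : (fun t : hS => u (s * (t : S))) =
    \sum_(d <- gsupp (gring_grading S) s)
      (fun t : hS => u (gproj (gring_grading S) d s * (t : S)) : M).
  apply/funext => t; rewrite fct_sumE {1}(gproj_sum (gring_grading S) s) mulr_suml.
  exact: (raddf_sum u).
apply: in_sum_big => // d.
have [r [f [_ cf ->]]] := homG_sumP u.
have -> : (fun t : hS => (\sum_(g <- r) f g) (gproj (gring_grading S) d s * (t : S))) =
   \sum_(g <- r) (fun t : hS => f g (gproj (gring_grading S) d s * (t : S))).
  by apply/funext => t; rewrite !fct_sumE.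
apply: in_sum_big => // g.
apply: (in_sum_homog c0 (g := d + g)); apply: coext_scale_comp => //.
exact: gproj_homog.
Qed.

Let scale (s : S) (u : hM) : hM := HomG (coext_scaleP s u).

Fact coext_scaleA a b u : scale a (scale b u) = scale (a * b) u.
Proof. by apply: homGP => t /=; rewrite mulrA [b * a]mulrC. Qed.
Fact coext_scale1 : left_id 1 scale.
Proof. by move=> u; apply: homGP => t /=; rewrite mul1r. Qed.
Fact coext_scaleDr : right_distributive scale +%R.
Proof. by move=> s u v; exact: homGP. Qed.
Fact coext_scaleDl u : {morph scale^~ u : a b / a + b}.
Proof.
move=> a b; apply: homGP => t /=; rewrite mulrDl.
by have := homG_linear u 1 (a * t) (b * t); rewrite !scale1r.
Qed.

HB.instance Definition _ := GRing.Zmodule_isLmodule.Build S hM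
  coext_scaleA coext_scale1 coext_scaleDr coext_scaleDl.

Lemma coext_scaleE (s : S) (u : hM) (t : S) : (s *: u : hM) t = u (s * t).
Proof. by []. Qed.

Fact coext_gmod_scale g g' (s : S) (u : hM) :
  gring_comp g s -> @homG_comp _ _ hS M g' u ->
  @homG_comp _ _ hS M (g + g') (s *: u : hM).
Proof. exact: coext_scale_comp. Qed.

Definition coext_mod : gradedModule S :=
  @GradedModule G S hM (@homG_comp _ _ hS M) (@homG_grading _ _ hS M)
    coext_gmod_scale.
End Coextension.

Section CoextFunctor.
Variables (G : zmodType) (R S : gradedRing G) (h : gradedRingHom R S).
Local Notation hS := (restr_mod h (regular S)).

Section Map.
Variables (M M' : gradedModule R) (f : gradedHom M M').

Fact coext_map_comp g (u : hS -> M) :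
  homG_fun_comp g u -> @homG_fun_comp _ _ hS M' g (fun t => f (u t)).
Proof.
move=> [k ->].
have l : linear (fun t : hS => f (k t) : shift M' g).
  move=> a x y; have -> : k (a *: x + y) = a *: (k x : M) + k y by rewrite linearP.
  by rewrite linearP.
have d b x : gmod_comp b x -> @gmod_comp _ _ (shift M' g) b (f (k x)).
  by move=> cx; apply: (ghom_deg f); exact: (ghom_deg k cx).
by exists (GradedHom l d).
Qed.

Fact coext_mapP (u : coext h M) : (fun t => f (u t)) \in @homG_pred _ _ hS M'.
Proof.
have [s [k [us ck e]]] := homG_sumP u; apply/asboolP.
exists s, (fun g t => f (k g t)); split => //.
- by move=> g; exact: coext_map_comp.
- by apply/funext => t; rewrite fct_sumE e fct_sumE raddf_sum.
Qed.

Definition coext_map_fun (u : coext_mod h M) : coext_mod h M' :=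
  HomG (coext_mapP u).

Fact coext_map_linear : linear coext_map_fun.
Proof. by move=> s u v; apply: homGP => t; exact: raddfD. Qed.

Fact coext_map_deg g u : gmod_comp g u -> gmod_comp g (coext_map_fun u).
Proof. exact: coext_map_comp. Qed.

Definition coext_map : gradedHom (coext_mod h M) (coext_mod h M') :=
  GradedHom coext_map_linear coext_map_deg.
End Map.

Fact coext_map1 M : coext_map (ghom_id M) = ghom_id (coext_mod h M).
Proof. by apply: gradedHomP => u; exact: homGP. Qed.

Fact coext_mapM (M N P : gradedModule R) (f : gradedHom N P)
    (k : gradedHom M N) :
  coext_map (ghom_comp f k) = ghom_comp (coext_map f) (coext_map k).
Proof. by apply: gradedHomP => u; exact: homGP. Qed.

Definition coextF : functor (ModG R) (ModG S) :=
  @Functor (ModG R) (ModG S) (coext_mod h) coext_map coext_map1 coext_mapM.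
End CoextFunctor.

Section Canonical.
Variables (G : zmodType) (R S : gradedRing G) (h : gradedRingHom R S).
Local Notation hS := (restr_mod h (regular S)).

Section Rho.
Variable M : gradedModule R.

Definition rho_fun (x : M) : restr_mod h (ext_mod h M) := pure h 1 x.

Fact rho_linear : linear rho_fun.
Proof.
move=> r x y; rewrite /rho_fun.
have -> : pure h 1 (r *: x + y) = pure h 1 (r *: x) + pure h 1 y.
  exact: tensorDr.
congr (_ + _); rewrite restr_scaleE ext_scaleE.
exact: esym (tensorZ r (1 : restr h S^o) x).
Qed.

Fact rho_deg g x : gmod_comp g x -> gmod_comp g (rho_fun x).
Proof.
move=> cx; apply: (@tens_comp_tensor _ _ hS M g 0 g (1 : S) x _ cx (add0r g)).
exact: (gring_comp1 S).
Qed.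

Definition rho_at : gradedHom M (restr_mod h (ext_mod h M)) :=
  GradedHom rho_linear rho_deg.
End Rho.

Fact rho_natural (M M' : gradedModule R) (f : gradedHom M M') :
  ghom_comp (rho_at M') f = ghom_comp (restr_map h (ext_map h f)) (rho_at M).
Proof. by apply: gradedHomP => x; rewrite /= ext_map_pure. Qed.

Definition rho : natTrans (idF (ModG R)) (compF (restrF h) (extF h)) :=
  @NatTrans _ _ (idF (ModG R)) (compF (restrF h) (extF h)) rho_at rho_natural.

Section Sigma.
Variable N : gradedModule S.

Definition sigma_fun (t : ext_mod h (restr_mod h N)) : N :=
  tens_lift (fun (s : restr h S^o) (x : restr h N) => (s : S) *: (x : N)) t.

Fact sigma_balanced :
  balanced (fun (s : restr h S^o) (x : restr h N) => (s : S) *: (x : N)).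
Proof.
split=> [a b x|a x y|r a x]; [exact: scalerDl|exact: scalerDr|].
by rewrite !restr_scaleE scalerA [_ * h r]mulrC.
Qed.

Fact sigma_pure s (x : N) : sigma_fun (pure h s (x : restr h N)) = s *: x.
Proof. exact: (tens_liftE sigma_balanced). Qed.

Fact sigmaB : zmod_morphism sigma_fun.
Proof. exact: (tens_lift_is_zmod_morphism sigma_balanced). Qed.

Fact sigma_linear : linear sigma_fun.
Proof.
move=> s t u.
have -> : sigma_fun (s *: t + u) = sigma_fun (s *: t) + sigma_fun u.
  exact: (tens_liftD sigma_balanced).
congr (_ + _); move: t.
apply: (ext_ext (f := fun t : ext_mod h (restr_mod h N) => sigma_fun (s *: t))
  (k := fun t : ext_mod h (restr_mod h N) => s *: sigma_fun t))
  => [p q|p q|s' x].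
- by rewrite -sigmaB -(scalerBr s (p : ext_mod h (restr_mod h N))).
- by rewrite -scalerBr -sigmaB.
- by rewrite ext_scaleE !sigma_pure scalerA.
Qed.

Fact sigma_deg g t : gmod_comp g t -> gmod_comp g (sigma_fun t).
Proof.
elim=> [|p q _ hp _ hq|a b s x cs cx <-].
- have -> : sigma_fun 0 = 0 by exact: (tens_lift0 sigma_balanced).
  exact: (grading0 (gmod_grading N)).
- have -> : sigma_fun (p - q) = sigma_fun p - sigma_fun q by exact: sigmaB.
  exact: (gradingB (gmod_grading N)).
- by rewrite sigma_pure; exact: gmod_scale.
Qed.

Definition sigma_at : gradedHom (ext_mod h (restr_mod h N)) N :=
  GradedHom sigma_linear sigma_deg.
End Sigma.

Fact sigma_natural (N N' : gradedModule S) (f : gradedHom N N') :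
  ghom_comp (sigma_at N') (ext_map h (restr_map h f)) =
  ghom_comp f (sigma_at N).
Proof.
apply: gradedHomP; apply: ext_ext => [p q|p q|s x] /=.
- by rewrite -sigmaB -ext_mapB.
- by rewrite -raddfB -sigmaB.
- by rewrite ext_map_pure !sigma_pure /= linearZ.
Qed.

Definition sigma : natTrans (compF (extF h) (restrF h)) (idF (ModG S)) :=
  @NatTrans _ _ (compF (extF h) (restrF h)) (idF (ModG S))
    sigma_at sigma_natural.

Section RhoTilde.
Variable N : gradedModule S.

Fact rho_tilde_comp g (x : N) : gmod_comp g x ->
  @homG_fun_comp _ _ hS (restr_mod h N) g (fun s : hS => (s : S) *: x).
Proof.
move=> cx.
have l : linear (fun s : hS => (s : S) *: x : shift (restr_mod h N) g).
  move=> a s t; have -> : ((a *: s + t : hS) : S) = h a * (s : S) + t by [].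
  by rewrite scalerDl -scalerA.
have d b (s : hS) : gmod_comp b s ->
    @gmod_comp _ _ (shift (restr_mod h N) g) b ((s : S) *: x).
  by move=> cs; have := gmod_scale cs cx; rewrite addrC.
by exists (GradedHom l d).
Qed.

Fact rho_tilde_fin (x : N) :
  (fun s : hS => (s : S) *: x) \in @homG_pred _ _ hS (restr_mod h N).
Proof.
set gr := gmod_grading N; apply/asboolP.
exists (gsupp gr x), (fun g (s : hS) => (s : S) *: gproj gr g x); split.
- exact: gsupp_uniq.
- by move=> g; apply: rho_tilde_comp; exact: gproj_homog.
- by apply/funext => s; rewrite fct_sumE {1}(gproj_sum gr x) scaler_sumr.
Qed.

Definition rho_tilde_fun (x : N) : coext_mod h (restr_mod h N) := HomG (rho_tilde_fin x).

Fact rho_tilde_linear : linear rho_tilde_fun.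
Proof.
move=> s x y; apply: homGP => t /=.
have -> : t *: (s *: x + y) = (s * t) *: x + (t : S) *: y.
  by rewrite scalerDr scalerA mulrC.
by [].
Qed.

Fact rho_tilde_deg g x : gmod_comp g x -> gmod_comp g (rho_tilde_fun x).
Proof. exact: rho_tilde_comp. Qed.

Definition rho_tilde_at : gradedHom N (coext_mod h (restr_mod h N)) :=
  GradedHom rho_tilde_linear rho_tilde_deg.
End RhoTilde.

Fact rho_tilde_natural (N N' : gradedModule S) (f : gradedHom N N') :
  ghom_comp (rho_tilde_at N') f =
  ghom_comp (coext_map h (restr_map h f)) (rho_tilde_at N).
Proof.
by apply: gradedHomP => x; apply: homGP => s; rewrite /= linearZ.
Qed.

Definition rho_tilde : natTrans (idF (ModG S)) (compF (coextF h) (restrF h)) :=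
  @NatTrans _ _ (idF (ModG S)) (compF (coextF h) (restrF h))
    rho_tilde_at rho_tilde_natural.

Section SigmaTilde.
Variable M : gradedModule R.

Definition sigma_tilde_fun (u : restr_mod h (coext_mod h M)) : M :=
  (u : homG hS M) (1 : S).

Fact sigma_tilde_linear : linear sigma_tilde_fun.
Proof.
move=> r u v; congr (_ + _).
have e : (u : homG hS M) (h r * (1 : S)) = r *: (u : homG hS M) (1 : S).
  exact: (linearZ_LR (u : homG hS M) r (1 : S)).
exact: e.
Qed.

Fact sigma_tilde_deg g u : gmod_comp g u -> gmod_comp g (sigma_tilde_fun u).
Proof.
move=> cu; rewrite -[g]addr0.
by apply: (homG_comp_deg (u := u : homG hS M)) => //; exact: (gring_comp1 S).
Qed.

Definition sigma_tilde_at : gradedHom (restr_mod h (coext_mod h M)) M :=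
  GradedHom sigma_tilde_linear sigma_tilde_deg.
End SigmaTilde.

Fact sigma_tilde_natural (M M' : gradedModule R) (f : gradedHom M M') :
  ghom_comp (sigma_tilde_at M') (restr_map h (coext_map h f)) =
  ghom_comp f (sigma_tilde_at M).
Proof. exact: gradedHomP. Qed.

Definition sigma_tilde : natTrans (compF (restrF h) (coextF h)) (idF (ModG R)) :=
  @NatTrans _ _ (compF (restrF h) (coextF h)) (idF (ModG R))
    sigma_tilde_at sigma_tilde_natural.
End Canonical.

(* Main.v *)
Require Import Defs.
From mathcomp Require Import all_boot all_algebra.
From mathcomp Require Import boolp.

Set Implicit Arguments.
Unset Strict Implicit.
Unset Printing Implicit Defensive.

Import GRing.Theory.
Local Open Scope ring_scope.

(** A pair of natural transformations [eta], [eps] satisfying the two triangle identities yields an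
    adjunction with exactly that unit and counit ([adjunction_of_triangles]), so the theorem reduces
    to four identities checked on elements. For extension of scalars they read $s\otimes x\mapsto
    s\otimes(1\otimes x)\mapsto s(1\otimes x)=s\otimes x$ and $x\mapsto 1\otimes x\mapsto 1x=x$. For
    coextension they read $x\mapsto(s\mapsto sx)\mapsto 1x=x$ and $u\mapsto(s\mapsto
    su)\mapsto(s\mapsto(su)(1)=u(s1))=u$. *)

Lemma natTransP (C D : category) (F U : functor C D) (e e' : natTrans F U) :
  (forall A, e A = e' A) -> e = e'.
Proof.
case: e e' => [e eP] [e' eP'] /= eqe.
have ee := functional_extensionality_dep eqe.
by case: _ / ee in eP' eqe *; rewrite (Prop_irrelevance eP eP').
Qed.

Section AdjunctionOfTriangles.
Variables (C D : category) (F : functor C D) (U : functor D C).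
Variables (eta : natTrans (idF C) (compF U F)).
Variables (eps : natTrans (compF F U) (idF D)).
Hypothesis triangleF : forall A, cmp (eps (F A)) (fmap F (eta A)) = idm (F A).
Hypothesis triangleU : forall B, cmp (fmap U (eps B)) (eta (U B)) = idm (U B).

Let to A B (k : Defs.hom (F A) B) : Defs.hom A (U B) := cmp (fmap U k) (eta A).
Let from A B (f : Defs.hom A (U B)) : Defs.hom (F A) B := cmp (eps B) (fmap F f).

Let toK A B : cancel (@to A B) (@from A B).
Proof.
move=> k; rewrite /from /to fmapM cmpA.
(* Naturality of the counit pulls [k] to the left, leaving the triangle at [F A]. *)
have /= -> := ncompP eps k.
by rewrite -cmpA triangleF cmpm1.
Qed.

Let fromK A B : cancel (@from A B) (@to A B).
Proof.
move=> f; rewrite /from /to fmapM -cmpA.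
(* Dually, naturality of the unit pushes [f] to the right, leaving the triangle at [U B]. *)
have /= <- := ncompP eta f.
by rewrite cmpA triangleU cmp1m.
Qed.

Let to_natl A A' B (f : Defs.hom A' A) (k : Defs.hom (F A) B) :
  to (cmp k (fmap F f)) = cmp (to k) f.
Proof.
rewrite /to fmapM -!cmpA; congr cmp.
exact: esym (ncompP eta f).
Qed.

Let to_natr A B B' (f : Defs.hom B B') (k : Defs.hom (F A) B) :
  to (cmp f k) = cmp (fmap U f) (to k).
Proof. by rewrite /to fmapM cmpA. Qed.

(** The unit and counit are the transposes of identities; since functors preserve identities, these
    collapse to the components of [eta] and [eps]. *)
Lemma adjunction_of_triangles :
  exists a : adjunction F U, adj_unit a = eta /\ adj_counit a = eps.
Proof.
exists (Adjunction toK fromK to_natl to_natr); split; apply: natTransP => A.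
- by rewrite /= /to fmap1 cmp1m.
- by rewrite /= /from fmap1 cmpm1.
Qed.
End AdjunctionOfTriangles.

Section Triangles.
Variables (G : zmodType) (R S : gradedRing G) (h : gradedRingHom R S).

Lemma sigma_ext_rho (M : gradedModule R) :
  ghom_comp (sigma_at h (ext_mod h M)) (ext_map h (rho_at h M)) =
  ghom_id (ext_mod h M).
Proof.
(* Both sides are additive, so comparing them on pure tensors suffices. *)
apply: gradedHomP; apply: ext_ext => [p q|p q //|s x] /=.
- by rewrite ext_mapB sigmaB.
- by rewrite ext_map_pure sigma_pure /= /rho_fun ext_scaleE mulr1.
Qed.

Lemma restr_sigma_rho (N : gradedModule S) :
  ghom_comp (restr_map h (sigma_at h N)) (rho_at h (restr_mod h N)) =
  ghom_id (restr_mod h N).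
Proof.
by apply: gradedHomP => x; rewrite /= /rho_fun sigma_pure scale1r.
Qed.

Lemma sigma_tilde_restr_rho_tilde (N : gradedModule S) :
  ghom_comp (sigma_tilde_at h (restr_mod h N)) (restr_map h (rho_tilde_at h N)) =
  ghom_id (restr_mod h N).
Proof. by apply: gradedHomP => x; exact: (scale1r (x : N)). Qed.

Lemma coext_sigma_tilde_rho_tilde (M : gradedModule R) :
  ghom_comp (coext_map h (sigma_tilde_at h M)) (rho_tilde_at h (coext_mod h M)) =
  ghom_id (coext_mod h M).
Proof.
apply: gradedHomP => u; apply: homGP => s.
(* The left side is $su$ evaluated at 1, and by definition $(su)(t)=u(st)$. *)
change (homG_fun u (s * 1 : S) = homG_fun u s).
by rewrite mulr1.
Qed.
End Triangles.

Theorem mainTheorem3 (G : zmodType) (R S : gradedRing G)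
    (h : gradedRingHom R S) :
  (exists a : adjunction (extF h) (restrF h),
     adj_unit a = rho h /\ adj_counit a = sigma h) /\
  (exists a : adjunction (restrF h) (coextF h),
     adj_unit a = rho_tilde h /\ adj_counit a = sigma_tilde h).
Proof.
split; apply: adjunction_of_triangles.
- exact: sigma_ext_rho.
- exact: restr_sigma_rho.
- exact: sigma_tilde_restr_rho_tilde.
- exact: coext_sigma_tilde_rho_tilde.
Qed.
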